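(* Let $\mathbf{k}$ be a field of characteristic two. There is only one possibility for an action of the Steenrod operations $\mathrm{Sq}^i$ ($i\ge 0$) on $\mathcal{E}_\infty(2)$ such that the Cartan formula $$\mathrm{Sq}^m(xy)=\sum_{i+j=m}\mathrm{Sq}^i(x)\,\mathrm{Sq}^j(y)$$ and the unstable conditions $\mathrm{Sq}^i(x)=x^2$ for $i=|x|$ and $\mathrm{Sq}^i(x)=0$ for $i>|x|$ hold. Namely, for homogeneous $x\in\mathcal{E}_\infty(2)$ we have $\mathrm{Sq}^{|x|}(x)=x^2$, and $\mathrm{Sq}^i(x)=0$ for $i\ne|x|$. In particular, if $x$ has degree greater than zero then $\mathrm{Sq}^0(x)=0$.
   Context: $R(n,2)=\mathbf{k}[x_1,\dots,x_n]$ is the $\mathbb{Z}[\frac12]$-graded polynomial algebra with $|x_i|=\frac{2^i-1}{2^i}$, and $\mathcal{E}_n(2)$ is its $\mathbb{Z}$-graded subalgebra consisting of the homogeneous components of integer degree. The inclusions $\mathcal{E}_{n-1}(2)\to\mathcal{E}_n(2)$ send each $x_i$ to the element of the same name, and $\mathcal{E}_\infty(2)=\varinjlim_n\mathcal{E}_n(2)$. An action of the Steenrod operations consists of additive maps $\mathrm{Sq}^i\colon\mathcal{E}_\infty(2)_d\to\mathcal{E}_\infty(2)_{d+i}$ for $i\ge 0$, $d\ge 0$. It is not assumed that $\mathrm{Sq}^0$ acts as the identity. $|x|$ denotes the degree of a homogeneous element $x$. *)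

(* Defs.v *)
From HB Require Import structures.
From mathcomp Require Import all_boot all_order all_algebra.
From mathcomp Require Import boolp finmap.
From mathcomp Require Import monalg.
(* mpoly last: its [msupp], [mmap], ['X_i] shadow the ones of monalg; since the
   notation [{mpoly R[n]}] is claimed by both files, [mpoly n R] is used. *)
From mathcomp Require Import mpoly.

Set Implicit Arguments.
Unset Strict Implicit.
Unset Printing Implicit Defensive.

Import GRing.Theory Num.Theory.
Local Open Scope ring_scope.

(* Variables are numbered from 0: ['X_i : mpoly n k] and [xinf k i] stand for
   x_(i+1), whose degree is (2^(i+1) - 1) / 2^(i+1). *)
Definition xdeg (i : nat) : rat := (2 ^+ i.+1 - 1) / 2 ^+ i.+1.

Definition mnmdeg (n : nat) (m : 'X_{1..n}) : rat := \sum_(i < n) xdeg i *+ m i.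

(* The homogeneous component of degree d of R(n,2) = k[x_1, ..., x_n]. *)
Definition Rhomog (k : fieldType) (n : nat) (d : rat) : pred (mpoly n k) :=
  fun p => all (fun m => mnmdeg m == d) (msupp p).

(* All degrees are nonnegative, so the integer-degree components, which make up
   E_n(2), are indexed by nat. *)
Definition Ehomog (k : fieldType) (n d : nat) : pred (mpoly n k) :=
  @Rhomog k n d%:R.

(* The polynomial algebra k[x_1, x_2, ...] in countably many variables. *)
Notation Rinf k := {malg k[{cmonom nat}]}.

Definition xinf (k : fieldType) (i : nat) : Rinf k :=
  mkmalgU (ucm i) (1 : k).

(* The k-algebra morphism k[x_1, ..., x_n] -> k[x_1, x_2, ...], x_i |-> x_i. *)
Definition toinf (k : fieldType) (n : nat) : mpoly n k -> Rinf k :=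
  mmap (GRing.in_alg (Rinf k)) (fun i : 'I_n => xinf k i).

HB.instance Definition _ (k : fieldType) (n : nat) :=
  GRing.RMorphism.copy (@toinf k n)
    (mmap (GRing.in_alg (Rinf k)) (fun i : 'I_n => xinf k i)).

(* The colimit of the E_n(2) along x_i |-> x_i (on polynomials, [mwiden]) is
   realized as the union of their images in k[x_1, x_2, ...]: the lemmas
   [toinf_mwiden] and [toinf_inj] below say that the maps [toinf] form a cocone
   of injections.  [Einf_pred k d] is the component of degree d. *)
Definition Einf_pred (k : fieldType) (d : nat) : pred (Rinf k) :=
  fun y => `[< exists n (p : mpoly n k), p \in @Ehomog k n d /\ toinf p = y >].
Arguments Einf_pred k d : clear implicits.

Section Colimit.
Variable k : fieldType.

Lemma toinfZ n c (p : mpoly n k) : toinf (c *: p) = c *: toinf p.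
Proof. by rewrite /toinf [LHS]mmapZ /= mulr_algl. Qed.

Lemma toinf_mwiden n (p : mpoly n k) : toinf (mwiden p) = toinf p.
Proof.
rewrite [p]mpolyE (raddf_sum (@mwiden n k)) !(raddf_sum (@toinf k _)) /=.
apply: eq_bigr => m _; rewrite mwidenZ mwidenX !toinfZ; congr (_ *: _).
rewrite /toinf [LHS]mmapX [RHS]mmapX.
rewrite /mmap1 [LHS]big_ord_recr mnmwiden_ordmax [X in _ * X = _]expr0.
by rewrite [LHS]mulr1; apply: eq_bigr => i _; rewrite mnmwiden_widen.
Qed.

Let cmon n (m : 'X_{1..n}) : {cmonom nat} :=
  \big[@mmul {cmonom nat}/mone]_(i < n) iterop (m i) (@mmul {cmonom nat}) (ucm (val i)) mone.

Let iterE e (u : {cmonom nat}) j :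
  iterop e (@mmul {cmonom nat}) u mone j = (e * u j)%N.
Proof.
rewrite Monoid.iteropE; elim: e => [|e IH] /=; first by rewrite cm1.
by rewrite cmM IH mulSn.
Qed.

Let cmonE n (m : 'X_{1..n}) (i : 'I_n) : cmon m i = m i.
Proof.
rewrite /cmon (big_morph (fun u : {cmonom nat} => u i)
  (id1 := 0%N) (op1 := addn)); last first.
- exact: cm1.
- by move=> u v; rewrite cmM.
rewrite (bigD1 i) //= iterE cmUU muln1 big1 ?addn0 // => j ne.
by rewrite iterE cmU val_eqE (negbTE ne) muln0.
Qed.

Let toinfX n (m : 'X_{1..n}) : toinf 'X_[m] = mkmalgU (cmon m) (1 : k) :> Rinf k.
Proof.
have mulU (u v : {cmonom nat}) :
    mkmalgU u (1 : k) * mkmalgU v (1 : k) = mkmalgU (mmul u v) (1 : k).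
  by rewrite -[LHS]/(fgmul _ _) fgmulUU mulr1.
rewrite /toinf mmapX /mmap1 /cmon.
rewrite [RHS](big_morph (fun u => mkmalgU u (1 : k) : Rinf k)
  (id1 := 1) (op1 := *%R)) //.
apply: eq_bigr => i _; rewrite Monoid.iteropE.
elim: (m i : nat) => [|e IH]; first by rewrite expr0.
by rewrite exprS IH /= -mulU.
Qed.

Lemma toinf_inj n : injective (@toinf k n).
Proof.
move=> p q epq; apply/mpolyP => m.
have co (r : mpoly n k) : monalg.mcoeff (cmon m) (toinf r) = r@_m.
  rewrite [r]mpolyE (raddf_sum (@toinf k n)) (raddf_sum (monalg.mcoeff _)).
  rewrite (raddf_sum (mcoeff m)) /=; apply: eq_bigr => m' _.
  rewrite mcoeffZ mcoeffX toinfZ toinfX.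
  rewrite monalg.mcoeffZ mcoeffU1; congr (_ * _%:R).
  congr nat_of_bool; apply/eqP/eqP => [e|-> //].
  by apply/mnmP => i; rewrite -!cmonE e.
by rewrite -!co epq.
Qed.

Lemma mnmdegD n (m m' : 'X_{1..n}) : mnmdeg (m + m')%MM = mnmdeg m + mnmdeg m'.
Proof.
by rewrite /mnmdeg -big_split; apply: eq_bigr => i _; rewrite mnmDE mulrnDr.
Qed.

Lemma Rhomog_mwiden n d (p : mpoly n k) :
  p \in @Rhomog k n d -> mwiden p \in @Rhomog k n.+1 d.
Proof.
move=> /allP hp; apply/allP => m.
rewrite [p]mpolyE (raddf_sum (@mwiden n k)) /= => /msupp_sum_le /flatten_mapP [m'].
rewrite filter_predT => m'p; rewrite mwidenZ mwidenX => /msuppZ_le.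
rewrite msuppX inE => /eqP ->; rewrite -(eqP (hp _ m'p)) /mnmdeg.
rewrite big_ord_recr /= mnmwiden_ordmax mulr0n addr0; apply/eqP.
by apply: eq_bigr => i _; rewrite mnmwiden_widen.
Qed.

Lemma RhomogB n d (p q : mpoly n k) :
  p \in @Rhomog k n d -> q \in @Rhomog k n d -> p - q \in @Rhomog k n d.
Proof.
move=> /allP hp /allP hq; apply/allP => m /msuppB_le.
by rewrite mem_cat => /orP[/hp|/hq].
Qed.

Lemma RhomogM n d e (p q : mpoly n k) :
  p \in @Rhomog k n d -> q \in @Rhomog k n e -> p * q \in @Rhomog k n (d + e).
Proof.
move=> /allP hp /allP hq; apply/allP => m /msuppM_le /allpairsP[[m1 m2]] /=.
by case=> /hp/eqP <- /hq/eqP <- ->; rewrite mnmdegD.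
Qed.

Lemma Ehomog_widen n N d (p : mpoly n k) : (n <= N)%N ->
  p \in @Ehomog k n d ->
  exists2 q : mpoly N k, q \in @Ehomog k N d & toinf q = toinf p.
Proof.
move=> /subnK <-; elim: (N - n)%N => [|e IH] hp; first by exists p.
have [q hq <-] := IH hp; exists (mwiden q); first exact: Rhomog_mwiden.
exact: toinf_mwiden.
Qed.

Lemma Einf_zmod_closed d : zmod_closed (Einf_pred k d).
Proof.
split=> [|x y].
  apply/asboolP; exists 0%N, 0; split; last exact: raddf0.
  by apply/allP => m; rewrite msupp0.
move=> /asboolP [n [p [hp <-]]] /asboolP [n' [q [hq <-]]].
have [p' hp' <-] := Ehomog_widen (leq_maxl n n') hp.
have [q' hq' <-] := Ehomog_widen (leq_maxr n n') hq.
apply/asboolP; exists (maxn n n'), (p' - q'); rewrite raddfB.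
by split=> //; apply: RhomogB.
Qed.

Lemma Einf_mul_closed d e x y :
  x \in Einf_pred k d -> y \in Einf_pred k e -> x * y \in Einf_pred k (d + e).
Proof.
move=> /asboolP [n [p [hp <-]]] /asboolP [n' [q [hq <-]]].
have [p' hp' <-] := Ehomog_widen (leq_maxl n n') hp.
have [q' hq' <-] := Ehomog_widen (leq_maxr n n') hq.
apply/asboolP; exists (maxn n n'), (p' * q'); rewrite rmorphM; split=> //.
by rewrite /Ehomog natrD; apply: RhomogM.
Qed.

End Colimit.

HB.instance Definition _ (k : fieldType) (d : nat) :=
  GRing.isZmodClosed.Build (Rinf k) (Einf_pred k d) (@Einf_zmod_closed k d).

(* The additive group of homogeneous elements of degree d of E_oo(2). *)
Record Einf (k : fieldType) (d : nat) := MkEinf {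
  Einf_val :> Rinf k;
  Einf_valP : Einf_val \in Einf_pred k d
}.

HB.instance Definition _ (k : fieldType) (d : nat) :=
  [isSub for @Einf_val k d].
HB.instance Definition _ (k : fieldType) (d : nat) :=
  [Choice of Einf k d by <:].
HB.instance Definition _ (k : fieldType) (d : nat) :=
  [SubChoice_isSubZmodule of Einf k d by <:].

Definition emul (k : fieldType) (d e : nat) (x : Einf k d) (y : Einf k e) :
    Einf k (d + e) :=
  MkEinf (Einf_mul_closed (Einf_valP x) (Einf_valP y)).

(* [Sq i d] is the operation Sq^i on the component of degree d. *)
Definition sq_operations (k : fieldType) : Type :=
  forall i d : nat, Einf k d -> Einf k (d + i).

(* The Cartan formula is written in k[x_1, x_2, ...], because its summands
   live in the components d + i + (e + (m - i)), which are equal to, but not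
   convertible with, d + e + m. *)
Record steenrod_action (k : fieldType) (Sq : sq_operations k) : Prop := {
  sq_additive : forall i d (x y : Einf k d),
    Sq i d (x + y) = Sq i d x + Sq i d y;
  sq_cartan : forall m d e (x : Einf k d) (y : Einf k e),
    Sq m (d + e)%N (emul x y) =
      \sum_(i < m.+1) Einf_val (Sq i d x) * Einf_val (Sq (m - i)%N e y)
        :> Rinf k;
  sq_top : forall d (x : Einf k d), Sq d d x = emul x x;
  sq_unstable : forall i d (x : Einf k d), (d < i)%N -> Sq i d x = 0
}.

(* Main.v *)
Require Import Defs.
From mathcomp Require Import all_boot all_order all_algebra.
From mathcomp Require Import boolp finmap monalg mpoly.
From mathcomp Require Import zify.

(** Let N = 2^i, m = x_i^N and u = x_(i+1)^(N (2N - 2)), elements of integer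
    degree. Their product is the N-th power of w = x_i x_(i+1)^(2N - 2), which
    again has integer degree, and in characteristic 2 the Cartan formula gives
    Sq^q (w^N) = 0 unless N divides q. By induction on 0 < j < N, the
    component of Sq (m u) lying j below the top degree is therefore
    0 = Sq^(|m|-j) m * u^2 + m^2 * Sq^(|u|-j) u. As m and u are coprime, m^2
    divides Sq^(|m|-j) m, whose degree is smaller than that of m^2, so
    Sq^(|m|-j) m = 0; as |m| = N - 1, this covers all lower operations on m.
    The property "Sq^i y = 0 for i <> |y|" is stable under products, 2^r-th
    roots and sums, and the (2^n)-th power of a monomial in x_1, ..., x_n is a
    product of such m's. *)

Set Implicit Arguments.
Unset Strict Implicit.
Unset Printing Implicit Defensive.

Import Order.TTheory GRing.Theory Num.Theory.
Local Open Scope ring_scope.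

(** * Identities in characteristic two *)

Lemma addr_eq0_char2 (V : zmodType) (addxx : forall y : V, y + y = 0)
    (x y : V) :
  x + y = 0 -> x = y.
Proof. by move=> e; apply: (addIr y); rewrite e addxx. Qed.

Lemma sqrrD_char2 (R : comNzRingType) (addxx : forall y : R, y + y = 0)
    (x y : R) :
  (x + y) ^+ 2 = x ^+ 2 + y ^+ 2.
Proof. by rewrite sqrrD mulr2n addxx addr0. Qed.

(** The terms at i and q - i are equal and cancel; only a middle term, present for even q, survives.
    The induction strips both end terms and passes from q to q - 2. *)
Lemma sum_symmetric_char2 (R : nzRingType) (addxx : forall y : R, y + y = 0)
    (q : nat) (f : nat -> nat -> R) :
    (forall i j, f i j = f j i) ->
  \sum_(i < q.+1) f i (q - i)%N = if odd q then 0 else f q./2 q./2.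
Proof.
elim/ltn_ind: q f => -[|[|q]] IH f fC.
- by rewrite big_ord1.
- by rewrite big_ord_recl big_ord1 /= fC addxx.
rewrite big_ord_recl big_ord_recr /= subn0 subnn /bump /= add1n.
rewrite (fC 0%N) addrCA addxx.
rewrite addr0 negbK -(IH q _ (fun i j => f i.+1 j.+1)) //.
apply: eq_bigr => i _; rewrite add1n.
by congr f; have := ltn_ord i; lia.
Qed.

(** * Degrees of monomials and divisibility in the colimit *)

Section Monomials.
Variable k : fieldType.

Lemma mnmdeg_mnm1 n (i : 'I_n) : mnmdeg U_(i) = xdeg i.
Proof.
rewrite /mnmdeg (bigD1 i) //= mnm1E eqxx big1 ?addr0 // => j ne.
by rewrite mnm1E eq_sym (negbTE ne).
Qed.

Lemma mnmdegMn n (m : 'X_{1..n}) a : mnmdeg (m *+ a)%MM = mnmdeg m *+ a.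
Proof.
rewrite /mnmdeg -sumrMnl; apply: eq_bigr => i _.
by rewrite mulmnE mulrnA.
Qed.

Lemma xdeg_ge0 i : 0 <= xdeg i.
Proof.
by rewrite /xdeg divr_ge0 ?exprn_ge0 // subr_ge0 exprn_ege1.
Qed.

(** The factor 2^(i+1) is the denominator of [xdeg i]. *)
Lemma xdegMn i c : xdeg i *+ (2 ^ i.+1 * c) = ((2 ^ i.+1).-1 * c)%:R.
Proof.
rewrite mulrnA natrM -[LHS]mulr_natr; congr (_ * _).
rewrite /xdeg -[LHS]mulr_natr natrX divfK ?expf_neq0 //.
by rewrite -subn1 natrB ?expn_gt0 // natrX.
Qed.

Lemma mnmdeg_ge n (m : 'X_{1..n}) (i : 'I_n) : xdeg i *+ m i <= mnmdeg m.
Proof.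
rewrite /mnmdeg (bigD1 i) //= lerDl sumr_ge0 // => j _.
by rewrite mulrn_wge0 ?xdeg_ge0.
Qed.

Lemma toinf_X n (m : 'X_{1..n}) :
  toinf ('X_[m] : mpoly n k) = \prod_(i < n) xinf k i ^+ m i.
Proof. exact: mmapX. Qed.

Lemma toinf_Xi n (i : 'I_n) : toinf ('X_i : mpoly n k) = xinf k i.
Proof. exact: (etrans (mmapX _ _ _) (mmap1U _ _)). Qed.

Lemma toinf_Xin n (i : 'I_n) a :
  toinf ('X_[U_(i) *+ a] : mpoly n k) = xinf k i ^+ a.
Proof. by rewrite -mpolyXn rmorphXn /= toinf_Xi. Qed.

Lemma toinf_mem n (d : nat) (p : mpoly n k) :
  p \in @Ehomog k n d -> toinf p \in Einf_pred k d.
Proof. by move=> hp; apply/asboolP; exists n, p. Qed.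

Lemma Ehomog_ZX n (d : nat) c (m : 'X_{1..n}) :
  mnmdeg m = d%:R -> c *: 'X_[m] \in @Ehomog k n d.
Proof.
move=> em; apply/allP => m' /msuppZ_le.
by rewrite msuppX inE => /eqP ->; rewrite em.
Qed.

Lemma toinfC_mem n c : toinf (c%:MP : mpoly n k) \in Einf_pred k 0.
Proof.
apply: toinf_mem; apply/allP => m; rewrite mpoly.msuppC.
case: ifP => // _; rewrite inE => /eqP ->.
by rewrite /mnmdeg big1 // => i _; rewrite mnm0E.
Qed.

Lemma Einf_mem1 : 1 \in Einf_pred k 0.
Proof. by have := toinfC_mem 0 1; rewrite !rmorph1. Qed.

Lemma xinf_mem i a b (d : nat) :
    xdeg i *+ a + xdeg i.+1 *+ b = d%:R ->
  xinf k i ^+ a * xinf k i.+1 ^+ b \in Einf_pred k d.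
Proof.
pose n := i.+2.
pose i0 : 'I_n := @Ordinal n i (leqW (leqnn _)).
pose i1 : 'I_n := @Ordinal n i.+1 (leqnn _).
move=> ed.
have := @Ehomog_ZX n d 1 (U_(i0) *+ a + U_(i1) *+ b)%MM.
rewrite mnmdegD !mnmdegMn !mnmdeg_mnm1 => /(_ ed) /toinf_mem.
by rewrite scale1r mpolyXD rmorphM /= !toinf_Xin.
Qed.

(** Brings identities in the colimit back to one polynomial ring; the bound [n0] ensures that
    prescribed variables are available there. *)
Lemma Einf_common_vars d e y z :
    y \in Einf_pred k d -> z \in Einf_pred k e -> forall n0,
  exists n (p q : mpoly n k),
    [/\ (n0 <= n)%N, p \in @Ehomog k n d, q \in @Ehomog k n e,
        toinf p = y & toinf q = z].
Proof.
move=> /asboolP [n [p [hp <-]]] /asboolP [n' [q [hq <-]]] n0.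
have le1 : (n <= maxn n0 (maxn n n'))%N by lia.
have le2 : (n' <= maxn n0 (maxn n n'))%N by lia.
have [p' hp' <-] := Ehomog_widen le1 hp.
have [q' hq' <-] := Ehomog_widen le2 hq.
by exists (maxn n0 (maxn n n')), p', q'; split=> //; rewrite leq_maxl.
Qed.

(** By injectivity of [toinf] the claim descends to a polynomial ring over a field, which is a
    domain. *)
Lemma Einf_expr2n_eq0 d y r : y \in Einf_pred k d -> y ^+ (2 ^ r) = 0 -> y = 0.
Proof.
move=> /asboolP [n [p [_ <-]]] /eqP.
rewrite -rmorphXn -(rmorph0 (@toinf k n)) => /eqP /toinf_inj /eqP.
by rewrite expf_eq0 => /andP[_ /eqP ->].
Qed.

(** Since i and j differ, x_i^t divides every monomial of y itself, which would then have degree at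
    least t |x_i| > c. Hence y has no monomials. *)
Lemma xinf_dvd_eq0 c e y z i j s t :
    y \in Einf_pred k c -> z \in Einf_pred k e -> i != j ->
    c%:R < xdeg i *+ t ->
    y * xinf k j ^+ s = xinf k i ^+ t * z ->
  y = 0.
Proof.
move=> hy hz ne lt.
have [n [p [q [len hp _ <- <-]]]] := Einf_common_vars hy hz (maxn i j).+1.
have lti : (i < n)%N by lia.
have ltj : (j < n)%N by lia.
pose i0 : 'I_n := Ordinal lti; pose j0 : 'I_n := Ordinal ltj.
move=> eyz.
have epq : p * 'X_[U_(j0) *+ s] = 'X_[U_(i0) *+ t] * q.
  by apply: toinf_inj; rewrite !rmorphM /= !toinf_Xin.
suff -> : p = 0 by rewrite rmorph0.
apply/mpolyP => m; rewrite mcoeff0; apply/eqP; rewrite mcoeff_eq0.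
apply/negP => mp; have /eqP dm := allP hp _ mp.
have : (m + U_(j0) *+ s)%MM \in msupp (p * 'X_[U_(j0) *+ s]).
  by rewrite mcoeff_msupp addmC mcoeffMX -mcoeff_msupp.
rewrite epq mulrC (perm_mem (msuppMX _ _)) => /mapP [m' _ em].
have : (t <= m i0)%N.
  have := congr1 (fun u : 'X_{1..n} => u i0) em.
  rewrite /= !mnmDE !mulmnE !mnm1E eqxx -val_eqE /= eq_sym (negbTE ne).
  by rewrite mul0n mul1n addn0 => ->; lia.
move=> /(ler_wpMn2l (xdeg_ge0 i)) le; have := mnmdeg_ge m i0.
by rewrite dm => /(le_trans le) /(lt_le_trans lt); rewrite ltxx.
Qed.

End Monomials.

(** * Consequences of the axioms for an arbitrary action *)

Section Action.
Variables (k : fieldType) (char_k : 2%N \in [pchar k]).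
Variables (Sq : sq_operations k) (actS : steenrod_action Sq).
Arguments Sq : clear implicits.

(* Extending the operations by junk outside of [Einf_pred k d] turns the
   dependently typed degrees into mere hypotheses. *)
Definition sqv (i d : nat) (y : Rinf k) : Rinf k :=
  Einf_val (Sq i d (insubd (0 : Einf k d) y)).

Lemma sqv_val i d (x : Einf k d) : sqv i d x = Sq i d x.
Proof. by rewrite /sqv valKd. Qed.

Lemma Rinf_addxx (y : Rinf k) : y + y = 0.
Proof.
have k2 : (1 + 1 : k) = 0 by have /andP[_ /eqP] := char_k.
by rewrite -[y]scale1r -scalerDl k2 scale0r.
Qed.

Lemma sqv_mem i d y : sqv i d y \in Einf_pred k (d + i).
Proof. exact: Einf_valP. Qed.

Lemma sqv_unstable i d y : (d < i)%N -> sqv i d y = 0.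
Proof. by move=> lt; rewrite /sqv (sq_unstable actS). Qed.

Lemma sqv_top d y : y \in Einf_pred k d -> sqv d d y = y ^+ 2.
Proof.
by move=> hy; rewrite -[y]/(val (MkEinf hy)) sqv_val (sq_top actS) expr2.
Qed.

Lemma sqv_add i d x y :
    x \in Einf_pred k d -> y \in Einf_pred k d ->
  sqv i d (x + y) = sqv i d x + sqv i d y.
Proof.
move=> hx hy; rewrite -[x]/(val (MkEinf hx)) -[y]/(val (MkEinf hy)).
by rewrite -[_ + _]/(val (MkEinf hx + MkEinf hy)) !sqv_val (sq_additive actS).
Qed.

Lemma sqv_cartan m d e x y :
    x \in Einf_pred k d -> y \in Einf_pred k e ->
  sqv m (d + e) (x * y) = \sum_(i < m.+1) sqv i d x * sqv (m - i) e y.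
Proof.
move=> hx hy; rewrite -[x]/(val (MkEinf hx)) -[y]/(val (MkEinf hy)).
rewrite -[_ * _]/(val (emul (MkEinf hx) (MkEinf hy))) sqv_val (sq_cartan actS).
by apply: eq_bigr => i _; rewrite !sqv_val.
Qed.

(** The Cartan sum for y y is symmetric, so only its middle term can survive. *)
Lemma sqv_sqr q d y : y \in Einf_pred k d ->
  sqv q (d + d) (y ^+ 2) = if odd q then 0 else sqv q./2 d y ^+ 2.
Proof.
move=> hy; rewrite expr2 sqv_cartan //.
rewrite (@sum_symmetric_char2 _ Rinf_addxx q (fun i j => sqv i d y * sqv j d y)).
  by rewrite expr2.
by move=> i j; rewrite mulrC.
Qed.

Lemma Einf_mem_exp2n r d y :
  y \in Einf_pred k d -> y ^+ (2 ^ r) \in Einf_pred k (2 ^ r * d).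
Proof.
move=> hy; elim: r => [|r IH]; first by rewrite mul1n.
by rewrite expnS mul2n -addnn mulnDl exprD; apply: Einf_mul_closed.
Qed.

Lemma sqv_exp2n r q d y : y \in Einf_pred k d ->
  sqv q (2 ^ r * d) (y ^+ (2 ^ r)) =
    if (2 ^ r %| q)%N then sqv (q %/ 2 ^ r) d y ^+ (2 ^ r) else 0.
Proof.
move=> hy; elim: r q => [|r IH] q; first by rewrite dvd1n divn1 mul1n.
have -> : (2 ^ r.+1 * d = 2 ^ r * d + 2 ^ r * d)%N by rewrite expnS; lia.
rewrite [in LHS]expnSr [in LHS]exprM sqv_sqr ?Einf_mem_exp2n // IH.
have [oq|eq] := boolP (odd q).
  case: ifP => //; rewrite expnS => /(dvdn_trans (dvdn_mulr _ (dvdnn 2))).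
  by rewrite dvdn2 oq.
have qE : q = (2 * q./2)%N by lia.
rewrite [in RHS]qE expnS dvdn_pmul2l // divnMl //.
by case: ifP => _; rewrite ?expr0n // mulnC exprM.
Qed.

(** Membership is part of the property, so that it is carried along in inductions over products and
    sums. *)
Definition sqv_only_top d y :=
  y \in Einf_pred k d /\ forall i, i <> d -> sqv i d y = 0.

Lemma sqv_only_top_mul d e x y :
  sqv_only_top d x -> sqv_only_top e y -> sqv_only_top (d + e) (x * y).
Proof.
move=> [hx ox] [hy oy]; split=> [|m ne]; first exact: Einf_mul_closed.
rewrite sqv_cartan // big1 // => i _.
have [eid|/eqP/ox ->] := eqVneq (i : nat) d; last by rewrite mul0r.
by rewrite [X in _ * X]oy ?mulr0 //; have := ltn_ord i; lia.
Qed.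

Lemma sqv_only_top0 y : y \in Einf_pred k 0 -> sqv_only_top 0 y.
Proof. by move=> hy; split=> // i /eqP; rewrite -lt0n => /sqv_unstable ->. Qed.

Lemma sqv_only_top_exp d y a :
  sqv_only_top d y -> sqv_only_top (d * a) (y ^+ a).
Proof.
move=> ty; elim: a => [|a IH].
  by rewrite muln0; apply/sqv_only_top0/Einf_mem1.
by rewrite mulnS exprS; apply: sqv_only_top_mul.
Qed.

(** The 2^r-th power of Sq^i y is Sq^(2^r i) of y^(2^r), which vanishes for i <> d; roots of zero
    are zero. *)
Lemma sqv_only_top_root r d y :
    y \in Einf_pred k d -> sqv_only_top (2 ^ r * d) (y ^+ (2 ^ r)) ->
  sqv_only_top d y.
Proof.
move=> hy [_ ty]; split=> // i ne.
apply: (Einf_expr2n_eq0 (sqv_mem i d y) (r := r)).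
have r_gt0 : (0 < 2 ^ r)%N by rewrite expn_gt0.
have e := sqv_exp2n r (2 ^ r * i) hy.
rewrite (dvdn_mulr i (dvdnn _)) (mulKn _ r_gt0) in e.
apply: etrans (esym e) _.
by apply: ty => /eqP; rewrite eqn_pmul2l // => /eqP.
Qed.

(** * Vanishing on powers of one variable, then on monomials and sums *)

Lemma sqv_xinf i :
  sqv_only_top (2 ^ i.+1).-1 (xinf k i ^+ (2 ^ i.+1)).
Proof.
(* [xinf k i] is x_(i+1), so N is the least positive exponent giving it an integer degree. *)
set N := (2 ^ i.+1)%N; set m := xinf k i ^+ N.
have N_gt1 : (1 < N)%N by rewrite /N -[1%N]/(2 ^ 0)%N ltn_exp2l.
pose e := (N * (2 * N.-1))%N; pose u := xinf k i.+1 ^+ e.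
(* The degrees of [m] and [u]. *)
pose a := N.-1; pose b := ((2 * N).-1 * N.-1)%N.
have deg_m : xdeg i *+ N = a%:R by rewrite -[N in LHS]muln1 xdegMn muln1.
have deg_u : xdeg i.+1 *+ e = b%:R.
  by rewrite /e mulnA [(N * 2)%N]mulnC -expnS xdegMn expnS.
have deg_mu : (a + b = N * (2 * N.-1))%N by rewrite /a /b; nia.
have hm : m \in Einf_pred k a.
  rewrite -[m]mulr1 -(expr0 (xinf k i.+1)); apply: xinf_mem.
  by rewrite mulr0n addr0.
have hu : u \in Einf_pred k b.
  rewrite -[u]mul1r -(expr0 (xinf k i)); apply: xinf_mem.
  by rewrite mulr0n add0r.
have hw : xinf k i * xinf k i.+1 ^+ (2 * N.-1) \in Einf_pred k (2 * N.-1).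
  (* The degree of w is checked after multiplication by N, which clears the denominators. *)
  apply: (@xinf_mem k i 1); apply: (@pmulrnI _ N); first by lia.
  rewrite mulrnDl -!mulrnA mul1n mulnC -/e [_ *+ e]deg_u deg_m.
  by rewrite -natrD deg_mu.
have wN : (xinf k i * xinf k i.+1 ^+ (2 * N.-1)) ^+ N = m * u.
  rewrite exprMn /u /e [(N * _)%N]mulnC.
  by rewrite -(exprM (xinf k i.+1) (2 * N.-1) N).
have gap j : (0 < j < N)%N -> sqv (a - j) a m = 0 /\ sqv (b - j) b u = 0.
  elim/ltn_ind: j => j IH jN.
  have le_ab : (a <= b)%N by rewrite /a /b; nia.
  have leja : (j <= a)%N by lia.
  (* N divides a + b = N |w| and 0 < j < N, so N does not divide a + b - j and this operation kills
     w^N = m u. *)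
  have := sqv_exp2n i.+1 (a + b - j) hw; rewrite -/N wN -deg_mu.
  have Nab : (N %| a + b)%N by rewrite deg_mu; apply: dvdn_mulr.
  have j_le : (j <= a + b)%N by lia.
  rewrite (dvdn_subr j_le Nab) gtnNdvd; [|lia|lia].
  have l1 : (a - j < (a + b - j).+1)%N by lia.
  have l2 : (a < (a + b - j).+1)%N by lia.
  rewrite sqv_cartan // (bigD1 (Ordinal l1)) // (bigD1 (Ordinal l2)) /=;
    last first.
    by rewrite -val_eqE /=; lia.
  rewrite big1; last first.
    (* The terms other than p = a - j and p = a vanish: for p > a the first factor is unstable, for
       p < a - j the second one is, and in between the induction hypothesis applies to a - p < j. *)
    move=> [p /= plt]; rewrite -!val_eqE /= => /andP[pj pa].
    have [lt|le] := ltnP a p; first by rewrite sqv_unstable ?mul0r.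
    have [lt|lt] := ltnP p (a - j).
      by rewrite [X in _ * X]sqv_unstable ?mulr0 //; lia.
    have -> : p = (a - (a - p))%N by lia.
    by have [|| ->] := IH (a - p)%N; [lia | lia | rewrite mul0r].
  rewrite [X in _ + X]addr0.
  have -> : (a + b - j - (a - j) = b)%N by lia.
  have -> : (a + b - j - a = b - j)%N by lia.
  rewrite !sqv_top // => e0.
  have e1 : sqv (a - j) a m * u ^+ 2 = m ^+ 2 * sqv (b - j) b u.
    exact: (addr_eq0_char2 Rinf_addxx e0).
  rewrite -[u ^+ 2](exprM (xinf k i.+1)) -[m ^+ 2](exprM (xinf k i)) in e1.
  split.
    apply: (xinf_dvd_eq0 (sqv_mem _ _ _) (sqv_mem _ _ _) _ _ e1); first lia.
    by rewrite mulrnA deg_m -mulrnA ltr_nat; lia.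
  (* The same argument with the roles exchanged: u^2 divides an element of degree 2b - j < 2b. *)
  have e2 := esym e1; rewrite mulrC [RHS]mulrC in e2.
  apply: (xinf_dvd_eq0 (sqv_mem _ _ _) (sqv_mem _ _ _) _ _ e2); first lia.
  by rewrite mulrnA deg_u -mulrnA ltr_nat; lia.
split=> // q ne; have [lt|le] := ltnP a q; first exact: sqv_unstable.
have -> : q = (a - (a - q))%N by rewrite /a in le *; lia.
by apply: (gap _ _).1; move: ne le; rewrite /a; lia.
Qed.

Lemma sqv_monomial n (m : 'X_{1..n}) d : mnmdeg m = d%:R ->
  sqv_only_top d (toinf 'X_[m]).
Proof.
move=> dm.
have hm : toinf 'X_[m] \in Einf_pred k d.
  by have /toinf_mem := Ehomog_ZX (1 : k) dm; rewrite scale1r.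
apply: (sqv_only_top_root (r := n)) => //.
(* The number of factors x_(i+1)^(2^(i+1)) in the 2^n-th power of the monomial; the exponent n
   suffices as i + 1 <= n. *)
pose c (i : 'I_n) := (2 ^ (n - i.+1) * m i)%N.
have cE (i : 'I_n) : (2 ^ i.+1 * c i = 2 ^ n * m i)%N.
  by rewrite /c mulnA -expnD subnKC.
(* The degree is written as a sum parallel to the product, for a simultaneous induction on both. *)
have -> : (2 ^ n * d = \sum_(i < n) (2 ^ i.+1).-1 * c i)%N.
  apply/eqP; rewrite -(eqr_nat rat) natrM -dm natr_sum; apply/eqP.
  rewrite /mnmdeg mulr_sumr; apply: eq_bigr => i _.
  by rewrite -xdegMn cE mulnC mulrnA mulr_natl.
rewrite toinf_X -prodrXl.
apply: (big_ind2 sqv_only_top) => [|d1 x1 d2 x2|i _].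
- exact/sqv_only_top0/Einf_mem1.
- exact: sqv_only_top_mul.
by rewrite -exprM [(m i * _)%N]mulnC -cE exprM; apply/sqv_only_top_exp/sqv_xinf.
Qed.

Lemma sqv_only_topE d y : y \in Einf_pred k d -> sqv_only_top d y.
Proof.
move=> /asboolP [n [p [/allP hp <-]]].
(* Sq^i 0 = 0 follows from additivity by cancellation. *)
have top0 : sqv_only_top d 0.
  split=> [|i _]; first exact: rpred0.
  apply: (addIr (sqv i d 0)).
  by rewrite -sqv_add ?rpred0 // addr0 add0r.
rewrite [p]mpolyE (raddf_sum (@toinf k n)).
rewrite big_seq; apply: (big_ind (sqv_only_top d)) => //.
  move=> x1 x2 [h1 t1] [h2 t2]; split=> [|i ne]; first exact: rpredD.
  by rewrite sqv_add // t1 // t2 // addr0.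
move=> m /hp /eqP dm.
(* The operations are only additive, so a scalar is treated as a factor of degree 0. *)
rewrite -mul_mpolyC /= rmorphM; apply: (@sqv_only_top_mul 0).
  exact/sqv_only_top0/toinfC_mem.
exact: sqv_monomial.
Qed.

End Action.

(** * Existence: squaring in the top degree defines an action *)

Section Existence.
Variables (k : fieldType) (char_k : 2%N \in [pchar k]).

Lemma frobenius_sq_mem (i d : nat) (x : Einf k d) :
  (if i == d then Einf_val x ^+ 2 else 0) \in Einf_pred k (d + i).
Proof.
case: eqP => [->|_]; last exact: rpred0.
by rewrite expr2; apply: Einf_mul_closed; apply: Einf_valP.
Qed.

Definition frobenius_sq : sq_operations k :=
  fun i d x => MkEinf (frobenius_sq_mem i x).

(** Additivity is the Frobenius identity. A Cartan term can be nonzero only if i = d and m - i = e,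
    hence m = d + e, and then it is x^2 y^2 = (x y)^2. *)
Lemma frobenius_sq_action : steenrod_action frobenius_sq.
Proof.
split=> [i d x y|m d e x y|d x|i d x lt].
- apply: val_inj => /=; case: eqP => _; last by rewrite addr0.
  exact: (sqrrD_char2 (Rinf_addxx char_k)).
- rewrite /=.
  have [->|ne] := eqVneq m (d + e)%N.
    have lt : (d < (d + e).+1)%N by lia.
    rewrite (bigD1 (Ordinal lt)) //= eqxx addKn eqxx exprMn big1 ?addr0 //.
    move=> i; rewrite -val_eqE /= => /negbTE ->.
    by rewrite mul0r.
  rewrite big1 // => i _; case: eqP => [id|_]; last by rewrite mul0r.
  case: eqP => [ie|_]; last by rewrite mulr0.
  by have := ltn_ord i; lia.
- by apply: val_inj; rewrite /= eqxx expr2.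
by apply: val_inj; rewrite /= ifF //; lia.
Qed.

End Existence.

(** * Uniqueness and the values of the operations *)

Lemma steenrod_action_eq0 (k : fieldType) (char_k : 2%N \in [pchar k])
    (Sq : sq_operations k) : steenrod_action Sq ->
  forall (i d : nat) (x : Einf k d), i <> d -> Sq i d x = 0.
Proof.
move=> actS i d x ne; apply: val_inj; rewrite /= -(sqv_val Sq).
by have [_ ->] := sqv_only_topE char_k actS (Einf_valP x).
Qed.

Theorem theorem5p1 (k : fieldType) (char_k : 2%N \in [pchar k]) :
  (exists! Sq : sq_operations k, steenrod_action Sq) /\
  (forall Sq : sq_operations k, steenrod_action Sq ->
    [/\ forall (d : nat) (x : Einf k d), Sq d d x = emul x x,
        forall (i d : nat) (x : Einf k d), i <> d -> Sq i d x = 0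
      & forall (d : nat) (x : Einf k d), (0 < d)%N -> Sq 0%N d x = 0]).
Proof.
split=> [|Sq actS]; last first.
  split=> [d x|i d x ne|d x d_gt0]; first exact: (sq_top actS).
    exact: steenrod_action_eq0.
  by apply: steenrod_action_eq0 => //; lia.
exists (@frobenius_sq k); split=> [|Sq actS]; first exact: frobenius_sq_action.
have actF := frobenius_sq_action char_k.
apply: functional_extensionality_dep => i.
apply: functional_extensionality_dep => d.
apply: functional_extensionality_dep => x.
have [->|/eqP ne] := eqVneq i d; first by rewrite (sq_top actS) (sq_top actF).
by rewrite !(steenrod_action_eq0 char_k _ _ ne).
Qed.
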